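(* Let $W\subset S^1$ with $|W|=4$, and suppose $R(W)$ holds, i.e., there exists $w_0\in W$ such that $\tau_{w_0}(W\setminus\{w_0\})\cap W=\emptyset$. Then $P(W)$ holds.
   Context: Identify $S^1$ with $\mathbb{R}/\mathbb{Z}$ (so $x\mapsto x+\tfrac12$ is the antipodal map). The group $O(2)$ acts on $S^1$ by translations $\sigma_a(x)=x+a$ and reflections $\tau_a(x)=-x+2a$. A coloring $c:S^1\to\{R,B\}$ is distinguishing if no non-identity $\gamma\in O(2)$ satisfies $c\circ\gamma=c$. For $W\subset S^1$ with trivial pointwise stabilizer in $O(2)$, $P(W)$ holds if every precoloring $c:S^1\setminus W\to\{R,B\}$ extends to a distinguishing coloring of $S^1$. *)

(* Defs.v *)
From Stdlib Require Import Reals List.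
Open Scope R_scope.

Lemma frac_part_range (x : R) : 0 <= frac_part x < 1.
Proof. destruct (base_fp x) as [H1 H2]. split; [apply Rge_le; exact H1 | exact H2]. Qed.

(* S^1 = R/Z, each point represented by its unique representative in [0,1). *)
Definition S1 : Type := { x : R | 0 <= x < 1 }.

Definition proj (x : R) : S1 := exist _ (frac_part x) (frac_part_range x).

Definition val1 (x : S1) : R := proj1_sig x.

Definition sigma (a x : S1) : S1 := proj (val1 x + val1 a).
Definition tau (a x : S1) : S1 := proj (- val1 x + 2 * val1 a).

(* Elements of O(2), via their action on S^1 (representation need not be
   unique; "identity" is always tested as a map). *)
Inductive O2 : Type :=
| Trans : S1 -> O2
| Refl : S1 -> O2.

Definition act (g : O2) (x : S1) : S1 :=
  match g with
  | Trans a => sigma a x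
  | Refl a => tau a x
  end.

Definition is_identity (g : O2) : Prop := forall x : S1, act g x = x.

Inductive color : Type := Red | Blue.

Definition distinguishing (c : S1 -> color) : Prop :=
  forall g : O2, (forall x : S1, c (act g x) = c x) -> is_identity g.

Definition trivial_pointwise_stabilizer (W : list S1) : Prop :=
  forall g : O2, (forall w, In w W -> act g w = w) -> is_identity g.

(* P(W): every precoloring of S^1 \ W extends to a distinguishing coloring.
   A precoloring of S^1 \ W is represented by a total function whose values
   on W are ignored. *)
Definition P_prop (W : list S1) : Prop :=
  forall c : S1 -> color,
    exists d : S1 -> color,
      (forall x, ~ In x W -> d x = c x) /\ distinguishing d.

Definition R_prop (W : list S1) : Prop :=
  exists w0, In w0 W /\
    forall w, In w W -> w <> w0 -> ~ In (tau w0 w) W.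

(* Main.v *)
Require Import Defs.
From Stdlib Require Import Reals List.
From Stdlib Require Import Bool ZArith Lra Lia Permutation Classical ClassicalEpsilon ProofIrrelevance.
Import ListNotations.

(* Put w0 at the origin and color the other three points like their mirror
   images. Consider the 14 recolorings of the four points that change one of
   those three, and suppose that none is distinguishing. None of them is
   symmetric about w0. None has a period either: changing the color of w0 would
   give a coloring without symmetries. So the i-th one is symmetric under some
   x |-> e_i - x with e_i <> 0. Composing the reflections of three recolorings
   gives an involution, which forces a short list of integer combinations of the
   e_i and the points to cancel in pairs in R/Z. A finite case analysis on which
   of them coincide, with linear algebra over the integers, contradicts the fact
   that the three points and their mirror images are six distinct points. *)

(** * Real numbers modulo the integers *)

Definition isint (r : R) : Prop := exists k : Z, r = IZR k.

Lemma isint_IZR (k : Z) : isint (IZR k).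
Proof. now exists k. Qed.

Lemma isint_plus (x y : R) : isint x -> isint y -> isint (x + y).
Proof. intros [k ->] [l ->]. exists (k + l)%Z. now rewrite plus_IZR. Qed.

Lemma isint_minus (x y : R) : isint x -> isint y -> isint (x - y).
Proof. intros [k ->] [l ->]. exists (k - l)%Z. now rewrite minus_IZR. Qed.

Lemma isint_mult (k : Z) (x : R) : isint x -> isint (IZR k * x).
Proof. intros [l ->]. exists (k * l)%Z. now rewrite mult_IZR. Qed.

Lemma isint_eq (x y : R) : isint x -> x = y -> isint y.
Proof. now intros H <-. Qed.

Ltac isint_from H := apply (isint_eq _ _ H); lra.

Lemma frac_part_minus_isint (x : R) : isint (x - frac_part x).
Proof. exists (Int_part x). unfold frac_part. lra. Qed.

Lemma S1_eq (s t : S1) : val1 s = val1 t -> s = t.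
Proof.
  destruct s as [x Hx], t as [y Hy]; simpl; intros ->.
  now rewrite (proof_irrelevance _ Hx Hy).
Qed.

Lemma S1_eq_isint (s t : S1) : isint (val1 s - val1 t) -> s = t.
Proof.
  intros [k Hk]. apply S1_eq.
  destruct s as [x Hx], t as [y Hy]; simpl in *.
  assert (H1 : (k < 1)%Z) by (apply lt_IZR; lra).
  assert (H2 : (-1 < k)%Z) by (apply lt_IZR; lra).
  assert (k = 0)%Z by lia. subst k. lra.
Qed.

Lemma proj_eq (x y : R) : proj x = proj y <-> isint (x - y).
Proof.
  pose proof (frac_part_minus_isint x) as Hx.
  pose proof (frac_part_minus_isint y) as Hy.
  split; intros H.
  - apply (f_equal val1) in H; simpl in H.
    isint_from (isint_minus _ _ Hx Hy).
  - apply S1_eq_isint; simpl.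
    isint_from (isint_plus _ _ (isint_minus _ _ H Hx) Hy).
Qed.

Lemma proj_val1 (s : S1) : proj (val1 s) = s.
Proof.
  apply S1_eq_isint; simpl.
  isint_from (isint_minus _ _ (isint_IZR 0) (frac_part_minus_isint (val1 s))).
Qed.

Lemma proj_eq_val1 (x : R) (s : S1) : proj x = s <-> isint (x - val1 s).
Proof. rewrite <- (proj_val1 s) at 1. apply proj_eq. Qed.

Lemma act_Trans_proj (a : S1) (x : R) : act (Trans a) (proj x) = proj (x + val1 a).
Proof.
  apply proj_eq; simpl.
  isint_from (isint_minus _ _ (isint_IZR 0) (frac_part_minus_isint x)).
Qed.

Lemma act_Refl_proj (a : S1) (x : R) : act (Refl a) (proj x) = proj (2 * val1 a - x).
Proof. apply proj_eq; simpl. isint_from (frac_part_minus_isint x). Qed.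

(** * Indicator functions of points of the circle *)

(** Made Boolean by classical choice, so that indicators and colorings can be added modulo 2 with
    [xorb]. *)
Definition hits (u x : R) : bool :=
  if excluded_middle_informative (isint (x - u)) then true else false.

Lemma hits_true (u x : R) : hits u x = true <-> isint (x - u).
Proof. unfold hits. destruct excluded_middle_informative; split; easy. Qed.

Lemma hits_false (u x : R) : hits u x = false <-> ~ isint (x - u).
Proof. unfold hits. destruct excluded_middle_informative; split; easy. Qed.

Lemma hits_iff (u x v y : R) :
  (isint (x - u) <-> isint (y - v)) -> hits u x = hits v y.
Proof.
  intros H. apply eq_iff_eq_true. now rewrite !hits_true.
Qed.

(** * Integer linear forms modulo the integers *)

(** Missing trailing coefficients count as zero, so [[]] is the zero form. *)
Definition vec := list Z.

Fixpoint eval (nu : list R) (v : vec) : R :=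
  match nu, v with
  | x :: nu', z :: v' => IZR z * x + eval nu' v'
  | _, _ => 0
  end.

Fixpoint vlin (k : Z) (u v : vec) : vec :=
  match u, v with
  | [], _ => map (Z.mul k) v
  | _, [] => u
  | x :: u', y :: v' => (x + k * y)%Z :: vlin k u' v'
  end.

Definition vadd := vlin 1.
Definition vsub := vlin (-1).

Lemma eval_nil_r (nu : list R) : eval nu [] = 0.
Proof. now destruct nu. Qed.

Lemma eval_scale (nu : list R) (k : Z) (v : vec) :
  eval nu (map (Z.mul k) v) = IZR k * eval nu v.
Proof.
  revert v; induction nu as [|x nu IH]; intros [|y v]; simpl; try ring.
  rewrite IH, mult_IZR. ring.
Qed.

Lemma eval_vlin (nu : list R) (k : Z) (u v : vec) :
  eval nu (vlin k u v) = eval nu u + IZR k * eval nu v.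
Proof.
  revert u v; induction nu as [|x nu IH]; intros [|y u] [|z v];
    simpl; try ring.
  - rewrite eval_scale, mult_IZR. ring.
  - rewrite IH, plus_IZR, mult_IZR. ring.
Qed.

Lemma eval_vadd (nu : list R) (u v : vec) :
  eval nu (vadd u v) = eval nu u + eval nu v.
Proof. unfold vadd. rewrite eval_vlin. ring. Qed.

Lemma eval_vsub (nu : list R) (u v : vec) :
  eval nu (vsub u v) = eval nu u - eval nu v.
Proof. unfold vsub. rewrite eval_vlin. ring. Qed.

Definition unit_vec (i : nat) : vec := repeat 0%Z i ++ [1%Z].

Lemma eval_unit_vec (nu : list R) (i : nat) : eval nu (unit_vec i) = nth i nu 0.
Proof.
  revert nu; induction i as [|i IH]; intros [|x nu]; simpl; try ring.
  - rewrite eval_nil_r. ring.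
  - unfold unit_vec in IH. rewrite IH. ring.
Qed.

Definition vzero (v : vec) : bool := forallb (Z.eqb 0) v.

Lemma eval_vzero (nu : list R) (v : vec) : vzero v = true -> eval nu v = 0.
Proof.
  revert v; induction nu as [|x nu IH]; intros [|z v] H; simpl; try easy.
  apply andb_true_iff in H as [Hz Hv].
  apply Z.eqb_eq in Hz. subst z. rewrite IH by easy. ring.
Qed.

(* An echelon system of forms that are known to be integers: the [i]-th row
   lists the coefficients from the [i]-th variable on; [[]] is an absent row. *)
Definition system := list vec.

Fixpoint satisfies (nu : list R) (B : system) : Prop :=
  match B, nu with
  | r :: B', _ :: nu' => isint (eval nu r) /\ satisfies nu' B'
  | _, _ => True
  end.

(** Division with remainder by the pivots. A form reduced to zero is an integer under every
    valuation that satisfies the system. *)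
Fixpoint reduce (B : system) (v : vec) : vec :=
  match B, v with
  | [] :: B', z :: v' => z :: reduce B' v'
  | (k :: r) :: B', z :: v' =>
      let q := (z / k)%Z in
      (z - q * k)%Z :: reduce B' (vlin (- q) v' r)
  | _, _ => v
  end.

Lemma reduce_isint (nu : list R) (B : system) (v : vec) :
  satisfies nu B -> isint (eval nu v - eval nu (reduce B v)).
Proof.
  revert B v; induction nu as [|x nu IH]; intros B v HB.
  { exists 0%Z. simpl. ring. }
  destruct B as [|r B]; [exists 0%Z; simpl; ring|].
  destruct v as [|z v]; [exists 0%Z; destruct r; simpl; ring|].
  destruct HB as [Hr HB].
  destruct r as [|k r]; simpl in *.
  - isint_from (IH B v HB).
  - set (q := (z / k)%Z) in *.
    pose proof (IH B (vlin (- q) v r) HB) as H.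
    rewrite eval_vlin, opp_IZR in H.
    apply (isint_eq _ _ (isint_plus _ _ H (isint_mult q _ Hr))).
    rewrite minus_IZR, mult_IZR. ring.
Qed.

(** Euclid's algorithm on the leading coefficients, by integer row operations: one row keeps their
    gcd up to sign, the other loses the variable. When the fuel runs out the second row is
    forgotten, which is sound. *)
Fixpoint euclid (n : nat) (r v : vec) : vec * vec :=
  match n, v with
  | _, 0%Z :: v' => (r, v')
  | _, [] => (r, [])
  | O, _ => (r, [])
  | S n', z :: _ => euclid n' v (vlin (- (hd 0%Z r / z)) r v)
  end.

Lemma euclid_isint (n : nat) (x : R) (nu : list R) (r v : vec) :
  isint (eval (x :: nu) r) -> isint (eval (x :: nu) v) ->
  isint (eval (x :: nu) (fst (euclid n r v))) /\
  isint (eval nu (snd (euclid n r v))).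
Proof.
  assert (H0 : isint (eval nu [])) by (rewrite eval_nil_r; apply isint_IZR).
  revert r v; induction n as [|n IH]; intros r [|z v] Hr Hv.
  - easy.
  - destruct z; try easy. split; [easy|]. simpl in *. isint_from Hv.
  - easy.
  - assert (Hstep : forall q, isint (eval (x :: nu) (vlin (- q) r (z :: v)))).
    { intros q. rewrite eval_vlin.
      apply isint_plus; [easy|]. now apply isint_mult. }
    destruct z; try (apply IH; [exact Hv | apply Hstep]).
    split; [easy|]. simpl in *. isint_from Hv.
Qed.

(* The fuel 50 only has to exceed the number of division steps. *)
Fixpoint insert (B : system) (v : vec) : system :=
  match B with
  | [] => []
  | r :: B' => let (r', v') := euclid 50 r v in r' :: insert B' v'
  end.

Lemma insert_satisfies (nu : list R) (B : system) (v : vec) :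
  satisfies nu B -> isint (eval nu v) -> satisfies nu (insert B v).
Proof.
  revert B v; induction nu as [|x nu IH]; intros [|r B] v HB Hv; try easy.
  - cbn [insert]. now destruct (euclid 50 r v).
  - destruct HB as [Hr HB].
    destruct (euclid_isint 50 x nu r v Hr Hv) as [H1 H2].
    cbn [insert]. destruct (euclid 50 r v) as [r' v']. simpl fst in *; simpl snd in *.
    split; [easy|]. now apply IH.
Qed.

(** * Parity relations and their refutation by case analysis *)

(** The sum modulo 2 of the indicators of the listed points; it vanishes when the points cancel in
    pairs. *)
Definition parity (nu : list R) (U : list vec) (x : R) : bool :=
  fold_right (fun u b => xorb (hits (eval nu u) x) b) false U.

Lemma parity_app (nu : list R) (U V : list vec) (x : R) :
  parity nu (U ++ V) x = xorb (parity nu U x) (parity nu V x).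
Proof.
  induction U as [|u U IH]; simpl; [now destruct parity|].
  now rewrite IH, xorb_assoc.
Qed.

Lemma parity_reflect (nu : list R) (e : vec) (U : list vec) (x : R) :
  parity nu (map (vsub e) U) x = parity nu U (eval nu e - x).
Proof.
  induction U as [|u U IH]; simpl; [easy|]. rewrite IH. f_equal.
  apply hits_iff. rewrite eval_vsub.
  split; intros H; isint_from (isint_minus _ _ (isint_IZR 0) H).
Qed.

Lemma parity_translate (nu : list R) (d : vec) (U : list vec) (x : R) :
  parity nu (map (vadd d) U) x = parity nu U (x - eval nu d).
Proof.
  induction U as [|u U IH]; simpl; [easy|]. rewrite IH. f_equal.
  apply hits_iff. rewrite eval_vadd. split; intros H; isint_from H.
Qed.

(** Equal forms cancel in pairs. They are compared through [vsub] because trailing zeros make lists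
    non-unique. *)
Fixpoint toggle (t : vec) (U : list vec) : list vec :=
  match U with
  | [] => [t]
  | u :: U' => if vzero (vsub u t) then U' else u :: toggle t U'
  end.

Lemma parity_toggle (nu : list R) (t : vec) (U : list vec) (x : R) :
  parity nu (toggle t U) x = xorb (hits (eval nu t) x) (parity nu U x).
Proof.
  induction U as [|u U IH]; simpl; [easy|].
  destruct (vzero (vsub u t)) eqn:E; simpl.
  - apply (eval_vzero nu) in E. rewrite eval_vsub in E.
    replace (eval nu t) with (eval nu u) by lra.
    now destruct (hits (eval nu u) x), (parity nu U x).
  - rewrite IH. now destruct (hits (eval nu u) x), (hits (eval nu t) x), (parity nu U x).
Qed.

Definition simplify (B : system) (U : list vec) : list vec :=
  fold_right (fun u V => toggle (reduce B u) V) [] U.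

Lemma parity_simplify (nu : list R) (B : system) (U : list vec) (x : R) :
  satisfies nu B -> parity nu (simplify B U) x = parity nu U x.
Proof.
  intros HB. induction U as [|u U IH]; simpl; [easy|].
  rewrite parity_toggle, IH. f_equal.
  pose proof (reduce_isint nu B u HB) as H.
  apply hits_iff. split; intros H1.
  - isint_from (isint_minus _ _ H1 H).
  - isint_from (isint_plus _ _ H1 H).
Qed.

(* [(g, U)]: if the form [g] is an integer, then every point of the circle
   occurs an even number of times in [U]. *)
Definition relation := (vec * list vec)%type.

Definition holds (nu : list R) (p : relation) : Prop :=
  isint (eval nu (fst p)) -> forall x, parity nu (snd p) x = false.

(* Some point of a relation is chosen and must coincide with one of the others;
   [skipped] keeps the relations whose guard is not yet known to hold. *)
Fixpoint refute (n : nat) (forbidden : list vec) (B : system)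
    (skipped todo : list relation) : bool :=
  match n, todo with
  | S n', (g, U) :: rest =>
      if vzero (reduce B g) then
        match simplify B U with
        | [] => refute n' forbidden B skipped rest
        (* An empty [V] closes the branch at once: a lone point has odd multiplicity. After an
           identification the skipped relations return, since their guards may now hold. *)
        | t :: V =>
            forallb (fun u =>
              let B' := insert B (vsub t u) in
              if existsb (fun f => vzero (reduce B' f)) forbidden then true
              else refute n' forbidden B' [] (rev_append skipped todo)) V
        end
      else refute n' forbidden B ((g, U) :: skipped) rest
  | _, _ => false
  end.

Lemma parity_true_in (nu : list R) (U : list vec) (x : R) :
  parity nu U x = true -> exists u, In u U /\ isint (x - eval nu u).
Proof.
  induction U as [|u U IH]; simpl; [easy|].
  destruct (hits (eval nu u) x) eqn:E.
  - intros _. exists u. split; [now left|]. now apply hits_true.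
  - intros H. destruct IH as [v [Hv Hx]].
    + now destruct (parity nu U x).
    + exists v. split; [now right | easy].
Qed.

(** At the chosen point [t] the parity vanishes, so under [nu] some other point [u] coincides with
    [t]. The branch of this [u] is still satisfied by [nu] and hence never closes. *)
Lemma refute_sound (nu : list R) (forbidden : list vec) (n : nat) :
  (forall f, In f forbidden -> ~ isint (eval nu f)) ->
  forall B skipped todo,
    satisfies nu B ->
    (forall p, In p skipped \/ In p todo -> holds nu p) ->
    refute n forbidden B skipped todo = false.
Proof.
  intros Hforb. induction n as [|n IH]; intros B skipped todo HB Hrel; [easy|].
  destruct todo as [|[g U] rest]; [easy|]. cbn [refute].
  assert (HgU : holds nu (g, U)) by (apply Hrel; right; now left).
  destruct (vzero (reduce B g)) eqn:Eg.
  - assert (Hpar : forall x, parity nu (simplify B U) x = false).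
    { intros x. rewrite parity_simplify by easy. apply HgU; simpl.
      pose proof (reduce_isint nu B g HB) as H.
      rewrite (eval_vzero nu (reduce B g) Eg) in H. isint_from H. }
    destruct (simplify B U) as [|t V].
    + apply IH; [easy|]. intros p [Hp|Hp]; apply Hrel; simpl; tauto.
    + specialize (Hpar (eval nu t)). simpl in Hpar.
      assert (Et : hits (eval nu t) (eval nu t) = true).
      { apply hits_true. exists 0%Z. simpl. ring. }
      rewrite Et in Hpar.
      destruct (parity_true_in nu V (eval nu t)) as [u [Hu Htu]].
      { now destruct (parity nu V (eval nu t)). }
      apply not_true_is_false. intros Hall.
      rewrite forallb_forall in Hall. specialize (Hall u Hu).
      cbv zeta in Hall.
      assert (HB' : satisfies nu (insert B (vsub t u))).
      { apply insert_satisfies; [easy|]. now rewrite eval_vsub. }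
      destruct existsb eqn:Hex.
      * apply existsb_exists in Hex as [f [Hf Ef]].
        apply (Hforb f Hf).
        pose proof (reduce_isint nu _ f HB') as H.
        rewrite (eval_vzero nu _ Ef) in H. isint_from H.
      * rewrite IH in Hall; [easy | easy |].
        intros p [[]|Hp]. rewrite rev_append_rev, in_app_iff, <- in_rev in Hp.
        now apply Hrel.
  - apply IH; [easy|]. intros p Hp. apply Hrel. simpl in *. intuition.
Qed.

(** * Relations coming from symmetric colorings *)

(** If the two reflections agree, the difference [U] of the colorings is invariant under them and
    cancels with its mirror image. *)
Definition pair_relation (e1 e2 : vec) (U : list vec) : relation :=
  (vsub e1 e2, U ++ map (vsub e1) U).

(** The six passages D1, D2, D3, D1, D2, D3, D1 contribute U, U+V, V, U, U+V, V, hence four images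
    of each list. The guard [[]] always holds. *)
Definition triple_relation (e1 e2 e3 : vec) (U V : list vec) : relation :=
  ([], V ++ map (vsub e3) V
       ++ map (vadd (vsub e1 e2)) V ++ map (vsub (vadd (vsub e1 e2) e3)) V
       ++ map (vsub e3) U ++ map (vsub e1) U
       ++ map (vadd (vsub e3 e2)) U ++ map (vadd (vsub e1 e2)) U).

Definition periodic (D : R -> bool) : Prop :=
  forall x y, isint (x - y) -> D x = D y.

Definition symmetric_about (D : R -> bool) (e : R) : Prop :=
  forall x, D (e - x) = D x.

Definition differ_on (nu : list R) (U : list vec) (D D' : R -> bool) : Prop :=
  forall x, parity nu U x = xorb (D x) (D' x).

Lemma pair_relation_holds (nu : list R) (e1 e2 : vec) (U : list vec)
    (D1 D2 : R -> bool) :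
  periodic D2 ->
  symmetric_about D1 (eval nu e1) -> symmetric_about D2 (eval nu e2) ->
  differ_on nu U D1 D2 ->
  holds nu (pair_relation e1 e2 U).
Proof.
  intros HP H1 H2 HU Hg x; simpl in *.
  rewrite eval_vsub in Hg.
  rewrite parity_app, parity_reflect, !HU, H1.
  rewrite (HP (eval nu e1 - x) (eval nu e2 - x)), H2 by isint_from Hg.
  now destruct (D1 x), (D2 x).
Qed.

(* The product of three reflections is an involution; going twice around it
   returns [D1] to itself, and the recolorings met on the way add up to zero. *)
Lemma triple_relation_holds (nu : list R) (e1 e2 e3 : vec) (U V : list vec)
    (D1 D2 D3 : R -> bool) :
  symmetric_about D1 (eval nu e1) -> symmetric_about D2 (eval nu e2) ->
  symmetric_about D3 (eval nu e3) ->
  differ_on nu U D1 D2 -> differ_on nu V D1 D3 ->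
  holds nu (triple_relation e1 e2 e3 U V).
Proof.
  intros H1 H2 H3 HU HV _ x; simpl.
  rewrite !parity_app, !parity_reflect, !parity_translate, !HU, !HV.
  rewrite !eval_vadd, !eval_vsub.
  set (f1 := eval nu e1) in *; set (f2 := eval nu e2) in *;
    set (f3 := eval nu e3) in *.
  (* The symmetries bring the arguments into a form in which every color occurs twice. *)
  rewrite (H1 x), (H3 x).
  rewrite <- (H1 (x - (f3 - f2))), <- (H2 (x - (f3 - f2))),
    <- (H2 (x - (f1 - f2))), <- (H3 (x - (f1 - f2))).
  replace (f1 - (x - (f3 - f2))) with (f1 - f2 + f3 - x) by ring.
  replace (f2 - (x - (f3 - f2))) with (f3 - x) by ring.
  replace (f2 - (x - (f1 - f2))) with (f1 - x) by ring.
  replace (f3 - (x - (f1 - f2))) with (f1 - f2 + f3 - x) by ring.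
  destruct (D1 x), (D3 x), (D1 (f3 - x)), (D1 (x - (f1 - f2))),
    (D1 (f1 - f2 + f3 - x)), (D3 (f1 - f2 + f3 - x)), (D2 (f3 - x)),
    (D2 (f1 - x)); reflexivity.
Qed.

(* A coloring of the four points is a number below 16, bit [k] telling whether
   the [k]-th point is recolored. Variables 0 to 15 are the reflections of the
   16 colorings, variables 16 to 18 the last three points; the point 0 is the
   origin. *)
Definition point (k : nat) : vec :=
  match k with O => [] | S k' => unit_vec (16 + k') end.

Definition recolored (m : nat) : list vec :=
  map point (filter (Nat.testbit m) (seq 0 4)).

Definition pair_of (i j : nat) : relation :=
  pair_relation (unit_vec i) (unit_vec j) (recolored (Nat.lxor i j)).

Definition triple_of (i j k : nat) : relation :=
  triple_relation (unit_vec i) (unit_vec j) (unit_vec k)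
    (recolored (Nat.lxor i j)) (recolored (Nat.lxor i k)).

(** The colorings obtained from [i] by toggling the points 0 and [w], for [i] with these bits zero.
    Each triple joins a corner to its two neighbors, so that [U] and [V] are single points. *)
Definition square (wb : nat * nat) : list relation :=
  let (w, i) := wb in
  let j := (i + 1)%nat in let k := (i + 2 ^ w)%nat in let l := (k + 1)%nat in
  [pair_of i j; pair_of i k; pair_of i l; pair_of j k; pair_of j l; pair_of k l;
   triple_of i j k; triple_of j i l; triple_of k i l; triple_of l j k].

(* The order of the squares is chosen to keep the search below small. *)
Definition relations : list relation :=
  flat_map square
    [(1, 8); (2, 8); (2, 10); (3, 6); (3, 4); (1, 4); (1, 12)]%nat.

(** The first forms express that the three points and their mirror images are distinct and differ
    from the origin, the last that no reflection fixes the origin. *)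
Definition forbidden : list vec :=
  flat_map (fun k => [point k; vadd (point k) (point k)]) [1; 2; 3]%nat
  ++ flat_map (fun kl => [vadd (point (fst kl)) (point (snd kl));
                          vsub (point (fst kl)) (point (snd kl))])
       [(1, 2); (1, 3); (2, 3)]%nat
  ++ map unit_vec (seq 2 14).


(** The search starts with 19 absent rows, one per variable; the fuel 2000 bounds its depth. *)
Lemma relations_refuted :
  refute 2000 forbidden (repeat [] 19) [] relations = true.
Proof. vm_compute. reflexivity. Qed.

(** * No family of reflections satisfies the relations *)

Definition valuation (e : nat -> R) (a b c : R) : list R :=
  map e (seq 0 16) ++ [a; b; c].

Lemma eval_reflection (e : nat -> R) (a b c : R) (i : nat) :
  (i < 16)%nat -> eval (valuation e a b c) (unit_vec i) = e i.
Proof.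
  intros Hi. rewrite eval_unit_vec.
  do 16 (destruct i as [|i]; [reflexivity|]). lia.
Qed.

Lemma square_holds (e : nat -> R) (a b c : R) (D : nat -> R -> bool) (w i : nat) :
  let nu := valuation e a b c in
  (forall i, periodic (D i)) ->
  (forall i, (2 <= i < 16)%nat -> symmetric_about (D i) (e i)) ->
  (forall i j, differ_on nu (recolored (Nat.lxor i j)) (D i) (D j)) ->
  (2 <= i)%nat -> (i + 2 ^ w + 1 < 16)%nat ->
  forall p, In p (square (w, i)) -> holds nu p.
Proof.
  intros nu HP Hsym Hdiff Hi Hw p Hp.
  assert (Hs : forall k, (2 <= k < 16)%nat ->
                 symmetric_about (D k) (eval nu (unit_vec k))).
  { intros k Hk. unfold nu. rewrite eval_reflection by lia. now apply Hsym. }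
  assert (Hpair : forall k l, (2 <= k < 16)%nat -> (2 <= l < 16)%nat ->
                    holds nu (pair_of k l)).
  { intros k l Hk Hl. apply pair_relation_holds with (D k) (D l); auto. }
  assert (Htriple : forall k l m, (2 <= k < 16)%nat -> (2 <= l < 16)%nat ->
                      (2 <= m < 16)%nat -> holds nu (triple_of k l m)).
  { intros k l m Hk Hl Hm.
    apply triple_relation_holds with (D k) (D l) (D m); auto. }
  unfold square in Hp; cbv zeta in Hp.
  repeat (destruct Hp as [<-|Hp]; [(apply Hpair || apply Htriple); lia|]).
  destruct Hp.
Qed.

Lemma no_reflective_family (e : nat -> R) (a b c : R) (D : nat -> R -> bool) :
  (forall i, periodic (D i)) ->
  (forall i, (2 <= i < 16)%nat -> symmetric_about (D i) (e i) /\ ~ isint (e i)) ->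
  (forall i j, differ_on (valuation e a b c) (recolored (Nat.lxor i j))
                 (D i) (D j)) ->
  (forall f, In f [a; a + a; b; b + b; c; c + c;
                   a + b; a - b; a + c; a - c; b + c; b - c] -> ~ isint f) ->
  False.
Proof.
  intros HP Hsym Hdiff Hpts.
  set (nu := valuation e a b c).
  assert (Href : refute 2000 forbidden (repeat [] 19) [] relations = false).
  { apply (refute_sound nu).
    - intros f Hf. unfold forbidden in Hf.
      rewrite app_assoc in Hf. apply in_app_or in Hf as [Hf|Hf].
      + apply Hpts.
        assert (Hpt : eval nu (point 1) = a /\ eval nu (point 2) = b
                      /\ eval nu (point 3) = c).
        { unfold point. rewrite !eval_unit_vec. repeat split; reflexivity. }
        destruct Hpt as [Ha [Hb Hc]].
        cbn [flat_map app fst snd] in Hf.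
        repeat (destruct Hf as [<-|Hf];
          [rewrite ?eval_vadd, ?eval_vsub, ?Ha, ?Hb, ?Hc; simpl; tauto|]).
        destruct Hf.
      + apply in_map_iff in Hf as [i [<- Hi]]. apply in_seq in Hi.
        unfold nu. rewrite eval_reflection by lia. apply Hsym. lia.
    - unfold nu, valuation. simpl.
      repeat (split; [exists 0%Z; reflexivity|]). easy.
    - intros p [[]|Hp].
      apply in_flat_map in Hp as [[w i] [Hwi Hp]].
      apply (square_holds e a b c D w i); auto.
      + intros k Hk. now apply Hsym.
      + simpl in Hwi. repeat (destruct Hwi as [[= <- <-]|Hwi]; [lia|]). easy.
      + simpl in Hwi.
        repeat (destruct Hwi as [[= <- <-]|Hwi]; [simpl; lia|]). easy. }
  rewrite relations_refuted in Href. discriminate.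
Qed.

(** * Symmetries of colorings *)

Definition red (k : color) : bool := match k with Red => true | Blue => false end.

(** The coordinate is centered at [w0], so that [tau w0] becomes negation. *)
Definition lift (w0 : S1) (d : S1 -> color) (y : R) : bool :=
  red (d (proj (y + val1 w0))).

Lemma lift_periodic (w0 : S1) (d : S1 -> color) : periodic (lift w0 d).
Proof.
  intros x y H. unfold lift. do 2 f_equal. apply proj_eq. isint_from H.
Qed.

Lemma not_distinguishing_symmetry (w0 : S1) (d : S1 -> color) :
  ~ distinguishing d ->
  (exists r, ~ isint r /\ forall y, lift w0 d (y + r) = lift w0 d y) \/
  (exists e, symmetric_about (lift w0 d) e).
Proof.
  intros H.
  apply not_all_ex_not in H as [g H].
  apply imply_to_and in H as [Hinv Hid].
  destruct g as [a|a].
  - left. exists (val1 a). split.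
    + intros Ha. apply Hid. intros s. simpl.
      apply proj_eq_val1. isint_from Ha.
    + intros y. unfold lift.
      rewrite <- (Hinv (proj (y + val1 w0))), act_Trans_proj.
      do 3 f_equal. ring.
  - right. exists (2 * val1 a - 2 * val1 w0). intros y. unfold lift.
    rewrite <- (Hinv (proj (y + val1 w0))), act_Refl_proj.
    do 3 f_equal. ring.
Qed.

(* If [D] had a period [r], the difference of [D'] and its own image under a
   symmetry of [D'] would be an [r]-invariant set of at most two points. *)
Lemma no_period_next_to_symmetry (D D' : R -> bool) (r : R) :
  periodic D -> periodic D' ->
  (forall y, D' y = xorb (hits 0 y) (D y)) ->
  ~ isint r -> (forall y, D (y + r) = D y) ->
  (exists s, ~ isint s /\ forall y, D' (y + s) = D' y) \/
  (exists e, ~ isint e /\ symmetric_about D' e) ->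
  False.
Proof.
  intros HP HP' Hdiff Hr HD Hsym.
  assert (H0 : forall y, isint y -> hits 0 y = true).
  { intros y Hy. apply hits_true. isint_from Hy. }
  assert (H1 : forall y, ~ isint y -> hits 0 y = false).
  { intros y Hy. apply hits_false. intros H. apply Hy. isint_from H. }
  assert (H2 : forall y, hits 0 y = true -> isint y).
  { intros y Hy. apply hits_true in Hy. isint_from Hy. }
  assert (Hint0 : isint 0) by apply isint_IZR.
  assert (Hnr : ~ isint (0 - r)).
  { intros H. apply Hr. isint_from (isint_minus _ _ (isint_IZR 0) H). }
  destruct Hsym as [[s [Hs HD']]|[e [He HD']]].
  (* [D] takes opposite colors at 0 and [s], but equal ones at 0 and [r]. Invariance of [D'] at [r]
     then requires a correction at [r + s], which must be the origin. *)
  - assert (Hrs : isint (r + s)).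
    { apply H2. pose proof (HD' 0) as E1. pose proof (HD' r) as E2.
      rewrite !Hdiff, (H0 0), (H1 (0 + s)) in E1
        by (rewrite ?Rplus_0_l; easy).
      rewrite !Hdiff, (H1 r) in E2 by easy.
      pose proof (HD 0) as E3. rewrite Rplus_0_l in E3.
      pose proof (HD (0 + s)) as E4.
      replace (0 + s + r) with (r + s) in E4 by ring.
      rewrite E3, E4 in E2.
      now destruct (hits 0 (r + s)), (D 0), (D (0 + s)). }
    pose proof (HD' (0 - s)) as E.
    replace (0 - s + s) with 0 in E by ring.
    rewrite (HP' (0 - s) r) in E.
    + rewrite !Hdiff, (H0 0), (H1 r) in E by easy.
      pose proof (HD 0) as E3. rewrite Rplus_0_l in E3. rewrite E3 in E.
      now destruct (D 0).
    + isint_from (isint_minus _ _ (isint_IZR 0) Hrs).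
  (* The same comparison at 0 and [r], with [e - r] in place of [r + s]. *)
  - assert (Her : isint (e - r)).
    { apply H2. pose proof (HD' 0) as E1. pose proof (HD' r) as E2.
      rewrite Rminus_0_r, !Hdiff, (H0 0), (H1 e) in E1 by easy.
      rewrite !Hdiff, (H1 r) in E2 by easy.
      pose proof (HD 0) as E3. rewrite Rplus_0_l in E3.
      pose proof (HD (e - r)) as E4.
      replace (e - r + r) with e in E4 by ring.
      rewrite E3, <- E4 in E2.
      now destruct (hits 0 (e - r)), (D 0), (D e). }
    pose proof (HD' 0) as E. rewrite Rminus_0_r in E.
    rewrite !Hdiff, (H0 0), (H1 e) in E by easy.
    rewrite (HP e (0 + r)), HD in E by isint_from Her.
    now destruct (D 0).
Qed.

(** * The family of recolorings of four points *)

(** The sum modulo 2 makes marks additive under [Nat.lxor] and matches [parity]. *)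
Definition mark (w : nat -> S1) (m : nat) (s : S1) : bool :=
  fold_right
    (fun k b => xorb (Nat.testbit m k && hits (val1 (w k)) (val1 s)) b)
    false (seq 0 4).

Definition swap (k : color) : color := match k with Red => Blue | Blue => Red end.

(** The point [w 0] is its own mirror image and keeps the color given by [c]. *)
Definition mirrored (w : nat -> S1) (c : S1 -> color) (s : S1) : color :=
  if excluded_middle_informative (exists k, (k < 4)%nat /\ s = w k)
  then c (tau (w 0%nat) s) else c s.

Definition recolor (w : nat -> S1) (c : S1 -> color) (m : nat) (s : S1) : color :=
  if mark w m s then swap (mirrored w c s) else mirrored w c s.

Lemma hits_val1 (s t : S1) : hits (val1 s) (val1 t) = true <-> t = s.
Proof.
  rewrite hits_true. split.
  - apply S1_eq_isint.
  - intros ->. exists 0%Z. simpl. ring.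
Qed.

Lemma hits_val1_neq (s t : S1) : t <> s -> hits (val1 s) (val1 t) = false.
Proof. intros H. apply not_true_is_false. now rewrite hits_val1. Qed.

Lemma mark_outside (w : nat -> S1) (m : nat) (s : S1) :
  (forall k, (k < 4)%nat -> s <> w k) -> mark w m s = false.
Proof.
  intros H. unfold mark; simpl.
  rewrite !hits_val1_neq by (apply H; lia). now rewrite !andb_false_r.
Qed.

Lemma mark_point (w : nat -> S1) (m k : nat) :
  (forall k l, (k < 4)%nat -> (l < 4)%nat -> w k = w l -> k = l) ->
  (k < 4)%nat -> mark w m (w k) = Nat.testbit m k.
Proof.
  intros Hinj Hk.
  assert (H : forall l, (l < 4)%nat ->
                hits (val1 (w l)) (val1 (w k)) = Nat.eqb k l).
  { intros l Hl. destruct (Nat.eqb_spec k l) as [<-|Hkl].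
    - now apply hits_val1.
    - apply hits_val1_neq. intros E. now apply Hkl, Hinj. }
  unfold mark; cbn [fold_right seq]. rewrite !H by lia.
  do 4 (destruct k as [|k]; [cbn [Nat.eqb];
    now rewrite ?andb_false_r, ?andb_true_r, ?xorb_false_r, ?xorb_false_l|]).
  lia.
Qed.

Lemma mark_lxor (w : nat -> S1) (i j : nat) (s : S1) :
  mark w (Nat.lxor i j) s = xorb (mark w i s) (mark w j s).
Proof.
  unfold mark; cbn [fold_right seq]. rewrite !Nat.lxor_spec.
  repeat match goal with |- context [Nat.testbit ?m ?k] =>
    generalize (Nat.testbit m k); intro end.
  repeat match goal with |- context [hits ?u ?x] =>
    generalize (hits u x); intro end.
  repeat match goal with b : bool |- _ => destruct b end; reflexivity.
Qed.

Lemma parity_recolored (e : nat -> R) (w : nat -> S1) (m : nat) (y : R) :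
  parity (valuation e (val1 (w 1%nat) - val1 (w 0%nat))
            (val1 (w 2%nat) - val1 (w 0%nat)) (val1 (w 3%nat) - val1 (w 0%nat)))
    (recolored m) y
  = mark w m (proj (y + val1 (w 0%nat))).
Proof.
  set (nu := valuation _ _ _ _).
  assert (Hpt : forall k, (k < 4)%nat ->
                  eval nu (point k) = val1 (w k) - val1 (w 0%nat)).
  { intros k Hk. unfold point, nu.
    do 4 (destruct k as [|k];
      [rewrite ?eval_unit_vec; simpl; ring|]). lia. }
  assert (Hh : forall k, (k < 4)%nat -> hits (eval nu (point k)) y
             = hits (val1 (w k)) (val1 (proj (y + val1 (w 0%nat))))).
  { intros k Hk. rewrite Hpt by easy.
    pose proof (frac_part_minus_isint (y + val1 (w 0%nat))) as Hf.
    apply hits_iff. simpl. split; intros H.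
    - isint_from (isint_minus _ _ H Hf).
    - isint_from (isint_plus _ _ H Hf). }
  unfold recolored, mark.
  assert (Hks : forall k, In k (seq 0 4) -> (k < 4)%nat)
    by (intros k Hk; apply in_seq in Hk; lia).
  induction (seq 0 4) as [|k ks IH]; [reflexivity|].
  cbn [filter fold_right].
  rewrite <- IH by (intros l Hl; apply Hks; now right).
  destruct (Nat.testbit m k); cbn [map parity fold_right andb].
  - now rewrite <- Hh by (apply Hks; now left).
  - now rewrite xorb_false_l.
Qed.

Lemma red_recolor (w : nat -> S1) (c : S1 -> color) (m : nat) (s : S1) :
  red (recolor w c m s) = xorb (mark w m s) (red (mirrored w c s)).
Proof. unfold recolor. now destruct (mark w m s), (mirrored w c s). Qed.

Lemma recolor_outside (w : nat -> S1) (c : S1 -> color) (m : nat) (s : S1) :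
  (forall k, (k < 4)%nat -> s <> w k) -> recolor w c m s = c s.
Proof.
  intros H. unfold recolor. rewrite mark_outside by easy.
  unfold mirrored. destruct excluded_middle_informative as [[k [Hk E]]|]; [|easy].
  now destruct (H k Hk).
Qed.

Lemma lift_recolor_lxor (w : nat -> S1) (c : S1 -> color) (i j : nat) (y : R) :
  mark w (Nat.lxor i j) (proj (y + val1 (w 0%nat)))
  = xorb (lift (w 0%nat) (recolor w c i) y) (lift (w 0%nat) (recolor w c j) y).
Proof.
  unfold lift. rewrite !red_recolor, mark_lxor.
  now destruct (mark w i _), (mark w j _), (red _).
Qed.

Lemma testbit_of_ge_2 (m : nat) :
  (2 <= m < 16)%nat -> exists k, (1 <= k < 4)%nat /\ Nat.testbit m k = true.
Proof.
  intros Hm.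
  do 2 (destruct m as [|m]; [lia|]).
  do 14 (destruct m as [|m];
    [(now exists 1%nat; split; [lia|]) || (now exists 2%nat; split; [lia|])
     || (now exists 3%nat; split; [lia|])|]).
  lia.
Qed.

(* A marked point is colored differently from its mirror image, which is not
   one of the four points. *)
Lemma recolor_not_mirrored (w : nat -> S1) (c : S1 -> color) (m : nat) (e : R) :
  (forall k l, (k < 4)%nat -> (l < 4)%nat -> w k = w l -> k = l) ->
  (forall k l, (1 <= k < 4)%nat -> (l < 4)%nat -> tau (w 0%nat) (w k) <> w l) ->
  (2 <= m < 16)%nat ->
  symmetric_about (lift (w 0%nat) (recolor w c m)) e -> ~ isint e.
Proof.
  intros Hinj HR Hm Hsym He.
  destruct (testbit_of_ge_2 m Hm) as [k [Hk Hbit]].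
  pose proof (Hsym (val1 (w k) - val1 (w 0%nat))) as E. unfold lift in E.
  assert (E1 : proj (e - (val1 (w k) - val1 (w 0%nat)) + val1 (w 0%nat))
               = tau (w 0%nat) (w k)).
  { apply proj_eq. isint_from He. }
  assert (E2 : proj (val1 (w k) - val1 (w 0%nat) + val1 (w 0%nat)) = w k).
  { rewrite <- (proj_val1 (w k)) at 2. f_equal. ring. }
  rewrite E1, E2, recolor_outside, red_recolor, mark_point, Hbit in E
    by (easy || lia || (intros l Hl; now apply HR)).
  unfold mirrored in E.
  destruct excluded_middle_informative as [_|H].
  - now destruct (c (tau (w 0%nat) (w k))).
  - apply H. exists k. split; [lia | easy].
Qed.

Lemma lxor_1_range (m : nat) :
  (2 <= m < 16)%nat -> (2 <= Nat.lxor m 1 < 16)%nat.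
Proof.
  intros Hm. do 2 (destruct m as [|m]; [lia|]).
  do 14 (destruct m as [|m]; [split; [apply Nat.leb_le | apply Nat.ltb_lt]; reflexivity|]).
  lia.
Qed.

(** A period is excluded by comparison with the coloring that differs only at [w 0]; what remains is
    a reflection, and it does not fix [w 0]. *)
Lemma recolor_reflection (w : nat -> S1) (c : S1 -> color) (m : nat) :
  (forall k l, (k < 4)%nat -> (l < 4)%nat -> w k = w l -> k = l) ->
  (forall k l, (1 <= k < 4)%nat -> (l < 4)%nat -> tau (w 0%nat) (w k) <> w l) ->
  (forall m, (m < 16)%nat -> ~ distinguishing (recolor w c m)) ->
  (2 <= m < 16)%nat ->
  exists e, symmetric_about (lift (w 0%nat) (recolor w c m)) e /\ ~ isint e.
Proof.
  intros Hinj HR Hnd Hm.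
  destruct (not_distinguishing_symmetry (w 0%nat) (recolor w c m))
    as [[r [Hr Hrot]]|[e He]].
  - apply Hnd. lia.
  - exfalso. set (m' := Nat.lxor m 1).
    assert (Hm' : (2 <= m' < 16)%nat) by now apply lxor_1_range.
    apply (no_period_next_to_symmetry (lift (w 0%nat) (recolor w c m))
             (lift (w 0%nat) (recolor w c m')) r); auto using lift_periodic.
    + intros y.
      pose proof (lift_recolor_lxor w c m' m y) as E.
      replace (Nat.lxor m' m) with 1%nat in E.
      2:{ unfold m'. rewrite (Nat.lxor_comm m 1), Nat.lxor_assoc,
            Nat.lxor_nilpotent. reflexivity. }
      replace (hits 0 y) with (mark w 1 (proj (y + val1 (w 0%nat)))).
      * rewrite E. now destruct (lift _ _ _), (lift _ _ _).
      * rewrite <- (parity_recolored (fun _ => 0)). simpl.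
        now rewrite xorb_false_r.
    + destruct (not_distinguishing_symmetry (w 0%nat) (recolor w c m'))
        as [H|[e He]]; [apply Hnd; lia | now left |].
      right. exists e. split; [|easy].
      now apply (recolor_not_mirrored w c m').
  - exists e. split; [easy|]. now apply (recolor_not_mirrored w c m).
Qed.

Lemma exists_distinguishing_recolor (w : nat -> S1) (c : S1 -> color) :
  (forall k l, (k < 4)%nat -> (l < 4)%nat -> w k = w l -> k = l) ->
  (forall k l, (1 <= k < 4)%nat -> (l < 4)%nat -> tau (w 0%nat) (w k) <> w l) ->
  exists m, distinguishing (recolor w c m).
Proof.
  intros Hinj HR. apply NNPP. intros Hno.
  assert (Hnd : forall m, (m < 16)%nat -> ~ distinguishing (recolor w c m)).
  { intros m _ H. apply Hno. now exists m. }
  set (D := fun m => lift (w 0%nat) (recolor w c m)).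
  (* One reflection is chosen for every [m]; the choice is meaningful for 2 <= m < 16. *)
  set (e := fun m => epsilon (inhabits 0)
              (fun e => symmetric_about (D m) e /\ ~ isint e)).
  set (x := fun k => val1 (w k) - val1 (w 0%nat)).
  assert (Hminus : forall k l, (k < 4)%nat -> (l < 4)%nat -> k <> l ->
                     ~ isint (x k - x l)).
  { intros k l Hk Hl Hkl H. apply Hkl, Hinj; try easy.
    apply S1_eq_isint. unfold x in H. isint_from H. }
  (* The case l = k says that 2 x_k is not an integer. *)
  assert (Hplus : forall k l, (1 <= k < 4)%nat -> (l < 4)%nat ->
                    ~ isint (x k + x l)).
  { intros k l Hk Hl H. apply (HR k l Hk Hl). apply proj_eq_val1.
    unfold x in H. isint_from (isint_minus _ _ (isint_IZR 0) H). }
  assert (Hx : forall k, (1 <= k < 4)%nat -> ~ isint (x k)).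
  { intros k Hk H. apply (Hminus k 0%nat); try lia.
    unfold x in *. isint_from H. }
  apply (no_reflective_family e (x 1%nat) (x 2%nat) (x 3%nat) D).
  - intros m. apply lift_periodic.
  - intros m Hm. apply epsilon_spec. now apply recolor_reflection.
  - intros i j y. unfold x. rewrite parity_recolored. apply lift_recolor_lxor.
  - intros f Hf. simpl in Hf.
    repeat (destruct Hf as [<-|Hf];
      [(apply Hx; lia) || (apply Hplus; lia) || (apply Hminus; lia)|]).
    destruct Hf.
Qed.

(** * The stabilizer and the final assembly *)

(** A translation with a fixed point is the identity. A reflection fixing [w0] acts as [tau w0], and
    if it fixed another point of [W] it would contradict [R_prop]. *)
Lemma R_prop_pointwise_stabilizer (W : list S1) :
  (exists w w', In w W /\ In w' W /\ w <> w') ->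
  R_prop W -> trivial_pointwise_stabilizer W.
Proof.
  intros [w1 [w2 [H1 [H2 H12]]]] [w0 [H0 HR]] g Hg.
  destruct g as [a|a]; simpl in Hg.
  - intros s. simpl. specialize (Hg w0 H0).
    apply proj_eq_val1 in Hg. apply proj_eq_val1. isint_from Hg.
  - exfalso.
    assert (Hw : exists w, In w W /\ w <> w0).
    { destruct (classic (w1 = w0)) as [->|]; [exists w2 | exists w1]; auto. }
    destruct Hw as [w [Hw Hne]]. apply (HR w Hw Hne).
    pose proof (Hg w0 H0) as E0. pose proof (Hg w Hw) as E.
    apply proj_eq_val1 in E0, E.
    replace (tau w0 w) with w; [easy|]. symmetry.
    apply proj_eq_val1. isint_from (isint_minus _ _ E E0).
Qed.

Theorem theorem2p2p2 (W : list S1) :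
  NoDup W -> length W = 4%nat -> R_prop W ->
  trivial_pointwise_stabilizer W /\ P_prop W.
Proof.
  intros Hnd Hlen HRW.
  pose proof HRW as [w0 [H0 HR]].
  destruct (in_split _ _ H0) as [l1 [l2 EW]].
  assert (HP : Permutation W (w0 :: l1 ++ l2))
    by (subst W; symmetry; apply Permutation_middle).
  pose proof (Permutation_length HP) as Hl. rewrite Hlen in Hl.
  destruct (l1 ++ l2) as [|w1 [|w2 [|w3 [|]]]]; try discriminate Hl.
  pose proof (Permutation_NoDup HP Hnd) as Hnd'.
  set (w := fun k => nth k [w0; w1; w2; w3] w0).
  assert (HwW : forall k, (k < 4)%nat -> In (w k) W).
  { intros k Hk. apply (Permutation_in _ (Permutation_sym HP)).
    now apply nth_In. }
  assert (Hinj : forall k l, (k < 4)%nat -> (l < 4)%nat -> w k = w l -> k = l).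
  { exact (proj1 (NoDup_nth _ w0) Hnd'). }
  split.
  - apply R_prop_pointwise_stabilizer; [|easy].
    exists (w 0%nat), (w 1%nat). repeat split; try (apply HwW; lia).
    intros E. apply Hinj in E; lia.
  - intros c.
    destruct (exists_distinguishing_recolor w c Hinj) as [m Hm].
    + intros k l Hk Hl4 E. apply (HR (w k)).
      * apply HwW. lia.
      * intros E'. assert (k = 0)%nat by (apply Hinj; easy || lia). lia.
      * change (w 0%nat) with w0 in E. rewrite E. now apply HwW.
    + exists (recolor w c m). split; [|easy].
      intros s Hs. apply recolor_outside. intros k Hk ->. now apply Hs, HwW.
Qed.
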